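(* Uniformly for all $n\ge1$ and $0\le p\le 1$, $$\frac{1}{\mathbb E\,\chi(G(n,p))}=(1-np)_+ + O\bigl(n^{-1/3}\bigr),$$ $$\frac{1}{\chi(G(n,p))}=(1-np)_+ + O_{\mathrm p}\bigl(n^{-1/3}\bigr).$$
   Context: $G(n,p)$ is the Erdős–Rényi random graph on $n$ vertices in which each possible edge is present independently with probability $p$. For a graph $G$ on $n$ vertices with connected components $\mathcal C_1,\dots,\mathcal C_K$, the susceptibility is $\chi(G)=\frac1n\sum_{i=1}^K|\mathcal C_i|^2$. $x_+=\max(x,0)$. The constant implicit in $O$ is absolute. $X=O_{\mathrm p}(a)$, for families of random variables $X=X_{n,p}$ and positive numbers $a=a_{n,p}$, means (uniformly) that for every $\varepsilon>0$ there is a constant $C_\varepsilon$ such that $\mathbb P(|X_{n,p}|>C_\varepsilon a_{n,p})<\varepsilon$ for all $n,p$ in the stated range. *)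

(* Defs.v *)
From HB Require Import structures.
From mathcomp Require Import all_boot all_order all_algebra.
From mathcomp Require Import reals exp.

Set Implicit Arguments.
Unset Strict Implicit.
Unset Printing Implicit Defensive.

Import Order.TTheory GRing.Theory Num.Theory.
Local Open Scope ring_scope.

Definition edge (n : nat) := {e : {set 'I_n} | #|e| == 2%N}.

(* A simple graph on the vertex set 'I_n is identified with its edge set, so
   the finType [graph n] enumerates every labelled simple graph exactly once. *)
Definition graph (n : nat) := {set edge n}.

Definition adjacent (n : nat) (G : graph n) : rel 'I_n :=
  fun x y => [exists e in G, val e == [set x; y]].

Definition components (n : nat) (G : graph n) : {set {set 'I_n}} :=
  equivalence_partition (connect (adjacent G)) [set: 'I_n].

Definition susceptibility (R : realType) (n : nat) (G : graph n) : R :=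
  n%:R^-1 * \sum_(C in components G) (#|C| ^ 2)%:R.

(* The law of G(n,p): the product over all possible edges of Bernoulli(p). *)
Definition gnp (R : realType) (n : nat) (p : R) (G : graph n) : R :=
  \prod_(e : edge n) (if e \in G then p else 1 - p).

Definition gnp_Pr (R : realType) (n : nat) (p : R) (A : pred (graph n)) : R :=
  \sum_(G : graph n | A G) gnp p G.

Definition gnp_E (R : realType) (n : nat) (p : R) (X : graph n -> R) : R :=
  \sum_(G : graph n) gnp p G * X G.

Lemma gnp_ge0 (R : realType) (n : nat) (p : R) (G : graph n) :
  0 <= p <= 1 -> 0 <= gnp p G.
Proof.
by case/andP=> p0 p1; apply: prodr_ge0 => e _; case: ifP; rewrite ?subr_ge0.
Qed.

Lemma gnp_sum1 (R : realType) (n : nat) (p : R) :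
  \sum_(G : graph n) gnp p G = 1.
Proof.
rewrite -(bigA_distr _ _ (fun=> p) (fun=> 1 - p)) big1 // => e _.
by rewrite /= addrC subrK.
Qed.

(* Independent Bernoulli(p) edges: every prescribed set S of edges is present
   with probability p ^ #|S|. *)
Lemma gnp_edges (R : realType) (n : nat) (p : R) (S : {set edge n}) :
  gnp_Pr p (fun G => S \subset G) = p ^+ #|S|.
Proof.
pose q e : R := if e \in S then 0 else 1 - p.
transitivity (\sum_(G : graph n) \prod_e (if e \in G then p else q e)).
  rewrite /gnp_Pr big_mkcond /=; apply: eq_bigr => G _; case: ifPn => SG.
    apply: eq_bigr => e _; case: ifPn => // eG; rewrite /q ifN //.
    by apply: contra eG; apply: subsetP.
  case/subsetPn: SG => e eS eG.
  by rewrite (bigD1 e) //= (negPf eG) /q eS mul0r.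
rewrite -(bigA_distr _ _ (fun=> p) q) (bigID (mem S)) /=.
rewrite [X in _ * X]big1 ?mulr1; last first.
  by move=> e /negPf; rewrite /q => /= ->; rewrite addrC subrK.
rewrite -prodr_const; apply: eq_bigr => e; rewrite /q => ->.
by rewrite addr0.
Qed.

(* The relation partitioned by [components] is an equivalence, so the blocks
   are the usual connected components. *)
Lemma components_partition (n : nat) (G : graph n) :
  partition (components G) [set: 'I_n].
Proof.
have adjC : symmetric (adjacent G).
  by move=> x y; apply: eq_existsb => e; rewrite setUC.
apply: equivalence_partitionP => x y z _ _ _; split; first exact: connect0.
by move=> xy; apply: (same_connect (sym_connect_sym adjC)) xy z.
Qed.

(* Main.v *)
Require Import Defs.
From HB Require Import structures.
From mathcomp Require Import all_boot all_order all_algebra.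
From mathcomp Require Import reals exp.
From mathcomp Require Import ring lra.

Set Implicit Arguments.
Unset Strict Implicit.
Unset Printing Implicit Defensive.

Import Order.TTheory GRing.Theory Num.Theory.
Local Open Scope ring_scope.

(* Write l = n p, d = 1 - l, and c(x) for the size of the cluster of x.  Deleting
   the last edge uv of a path from x to v shows that E[c(x)] <= 1 + l E[c(x)];
   the same deletion, together with a van den Berg-Kesten bound for disjoint
   clusters, gives E[c(x)^2] <= d^(-3) and E[c(x)^3] <= 3 d^(-5) when l < 1.
   Conversely, for each v at most one edge uv is a bridge separating v from x, so
   that d E[c(x)] >= 1 - p E[c(x)^2].  Hence d^(-1) - d^(-4) / n <= E chi <= d^(-1),
   while Var chi <= 3 d^(-5) / n by the third moment.  With s = n^(-1/3), this
   yields both estimates when d >= 4 k s, the second one by Chebyshev's inequality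
   with k large; the remaining p follow by monotonicity from the value of p for
   which d = 4 k s. *)

(** * Clusters, edge deletion and bridges in a fixed graph *)

Section Graph.
Variable n : nat.
Implicit Types (G H K D S : graph n) (x y u v w : 'I_n).

Definition conn G := connect (adjacent G).
Definition cluster G x : {set 'I_n} := [set y | conn G x y].

Lemma adjacentC G : symmetric (adjacent G).
Proof. by move=> x y; apply: eq_existsb => e; rewrite setUC. Qed.

Lemma connC G : symmetric (conn G).
Proof. exact: sym_connect_sym (adjacentC G). Qed.

Lemma conn_refl G x : conn G x x. Proof. exact: connect0. Qed.

Lemma conn_trans G : transitive (conn G).
Proof. by move=> y x z; exact: connect_trans. Qed.

Lemma conn_adjacent G x y : adjacent G x y -> conn G x y.
Proof. exact: connect1. Qed.

Lemma in_cluster G x y : (y \in cluster G x) = conn G x y.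
Proof. by rewrite inE. Qed.

Lemma adjacentP G x y :
  reflect (exists2 e, e \in G & val e = [set x; y]) (adjacent G x y).
Proof.
apply: (iffP existsP) => [[e /andP[eG /eqP ee]]|[e eG ee]]; exists e => //.
by rewrite eG ee eqxx.
Qed.

Lemma adjacentS G H x y : G \subset H -> adjacent G x y -> adjacent H x y.
Proof.
by move=> GH /adjacentP[e eG ee]; apply/adjacentP; exists e => //; apply: (subsetP GH).
Qed.

Lemma adjacent_neq G x y : adjacent G x y -> x != y.
Proof.
case/adjacentP=> e _ ee; have := valP e.
by rewrite /= ee cards2; case: (x != y).
Qed.

Lemma adjacent_edge x y : x != y -> exists e : edge n, val e = [set x; y].
Proof.
move=> xy; have h : #|[set x; y]| == 2%N by rewrite cards2 xy.
by exists (exist (fun e : {set 'I_n} => #|e| == 2%N) _ h).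
Qed.

Lemma conn_closed G (A : {set 'I_n}) x y :
    (forall a b, a \in A -> adjacent G a b -> b \in A) ->
  x \in A -> conn G x y -> y \in A.
Proof.
move=> clA xA /connectP[q qP ->] {y}.
elim: q x xA qP => //= a q IH x xA /andP[xa aq].
by apply: IH => //; apply: clA xa.
Qed.

(** A path from [x] only uses edges at vertices of the cluster of [x], so [H] need only contain
    those. *)
Lemma conn_transfer G H x y :
    (forall a b, conn G x a -> adjacent G a b -> adjacent H a b) ->
  conn G x y -> conn H x y.
Proof.
move=> GH xy; suff: y \in [set a | conn G x a && conn H x a] by rewrite inE => /andP[].
apply: conn_closed xy; rewrite ?inE ?conn_refl // => a b.
rewrite !inE => /andP[Ga Ha] ab; apply/andP; split.
  exact: conn_trans Ga (conn_adjacent ab).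
exact: conn_trans Ha (conn_adjacent (GH _ _ Ga ab)).
Qed.

Lemma connS G H x y : G \subset H -> conn G x y -> conn H x y.
Proof. by move=> GH; apply: conn_transfer => a b _; apply: adjacentS. Qed.

Lemma clusterS G H x : G \subset H -> cluster G x \subset cluster H x.
Proof. by move=> GH; apply/subsetP=> y; rewrite !inE; apply: connS. Qed.

Lemma cluster_gt0 G x : (0 < #|cluster G x|)%N.
Proof. by apply/card_gt0P; exists x; rewrite inE conn_refl. Qed.

(** Exploring the cluster of [x] only examines the edges that meet it; altering any other edge
    leaves the cluster unchanged. The swapping argument for disjoint clusters rests on this. *)
Lemma eq_cluster G H x :
    (forall e : edge n, ~~ [disjoint val e & cluster G x] -> (e \in G) = (e \in H)) ->
  cluster H x = cluster G x.
Proof.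
move=> GH; apply/eqP; rewrite eqEsubset; apply/andP; split; apply/subsetP => y.
  rewrite [y \in cluster H x]in_cluster; apply: conn_closed => [a b ax|]; last first.
    by rewrite inE conn_refl.
  move=> /adjacentP[e eH ee]; rewrite inE; move: (ax); rewrite inE => /conn_trans; apply.
  apply: conn_adjacent; apply/adjacentP; exists e => //; rewrite GH //.
  by apply/pred0Pn; exists a; rewrite /= ax ee !inE eqxx.
rewrite !inE; apply: conn_transfer => a b ax /adjacentP[e eG ee].
apply/adjacentP; exists e; rewrite -?GH //.
by apply/pred0Pn; exists a; rewrite /= in_cluster ax ee !inE eqxx.
Qed.

(** As a set of edges it has at most one element and is empty when [u = v], so that deleting it
    requires no proof that [u] and [v] differ. *)
Definition link u v : graph n := [set e | val e == [set u; v]].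

Lemma adjacent_link G u v a b :
  adjacent (G :\: link u v) a b = adjacent G a b && ([set a; b] != [set u; v]).
Proof.
apply/idP/andP=> [/adjacentP[e]|[/adjacentP[e eG ee] ne]].
  rewrite !inE => /andP[ne eG] ee; rewrite -ee ne; split=> //.
  by apply/adjacentP; exists e.
by apply/adjacentP; exists e; rewrite // !inE ee ne.
Qed.

Lemma adjacent_setI G u v : adjacent (G :&: link u v) u v = adjacent G u v.
Proof.
apply/adjacentP/adjacentP=> -[e]; first by rewrite inE => /andP[eG _] ee; exists e.
by move=> eG ee; exists e; rewrite // !inE eG ee eqxx.
Qed.

(** On a path from [x] to [v] without repeated vertices, every vertex before the end differs from
    [v], so only the last edge can be [uv]. *)
Lemma conn_last_edge G x v : v != x -> conn G x v ->
  exists2 u, adjacent G u v & conn (G :\: link u v) x u.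
Proof.
move=> vx /connectP[q qP def_v].
case/shortenP: qP def_v => q' q'P uq _ {q}.
case: (lastP q') q'P uq => [|q u'] /=; first by move=> _ _ E; rewrite E eqxx in vx.
rewrite last_rcons rcons_path => /andP[qP lu]; rewrite mem_rcons in_cons rcons_uniq.
rewrite negb_or => /andP[/andP[xu xq] /andP[uq _]] E; rewrite -{u'}E in lu uq xu *.
exists (last x q) => //; apply/connectP; exists q => //.
apply: (@sub_in_path _ [pred z | z != v] (adjacent G)) (qP) => [a b /= av bv ab|].
  rewrite adjacent_link ab; apply/negP=> /eqP/setP/(_ v).
  by rewrite !inE eqxx orbT eq_sym (negPf av) eq_sym (negPf bv).
rewrite /= eq_sym vx; apply/allP=> z zq; apply: contraNneq uq => <-; exact: zq.
Qed.

(** The union on the right is closed under adjacency in [G]: both ends of [uv] lie in it, and every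
    other edge survives the deletion. *)
Lemma cluster_link G x u v : conn (G :\: link u v) x u ->
  cluster G x \subset cluster (G :\: link u v) x :|: cluster (G :\: link u v) v.
Proof.
move=> xu; apply/subsetP=> y; rewrite in_cluster; apply: conn_closed; last first.
  by rewrite !inE conn_refl.
move=> a b aU ab.
have [E|ne] := eqVneq [set a; b] [set u; v].
  have: b \in [set u; v] by rewrite -E !inE eqxx orbT.
  by rewrite !inE => /orP[]/eqP ->; rewrite ?xu ?conn_refl ?orbT.
have {}ab : adjacent (G :\: link u v) a b by rewrite adjacent_link ab.
have {}ab := conn_adjacent ab.
by move: aU; rewrite !inE => /orP[] h; rewrite (conn_trans h ab) ?orbT.
Qed.

Lemma card_cluster_link G x u v : conn (G :\: link u v) x u ->
  (#|cluster G x| <= #|cluster (G :\: link u v) x| +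
     (if conn (G :\: link u v) x v then 0 else #|cluster (G :\: link u v) v|))%N.
Proof.
move=> xu; apply: leq_trans (subset_leq_card (cluster_link xu)) _.
case: ifPn => xv; last by rewrite cardsU leq_subr.
rewrite addn0; apply: subset_leq_card; rewrite subUset subxx /=.
by apply/subsetP=> y; rewrite !inE; apply: conn_trans.
Qed.

Definition bridge_to G x u v :=
  [&& adjacent G u v, conn (G :\: link u v) x u & ~~ conn (G :\: link u v) x v].

(** A path from [x] to [u'] that does not use [u'v] avoids [v], since [v] is unreachable without
    that edge. If [u] and [u'] differed, this path followed by [u'v] would reach [v] without
    [uv]. *)
Lemma bridge_to_uniq G x u u' v : bridge_to G x u v -> bridge_to G x u' v -> u = u'.
Proof.
case/and3P=> uv xu xv /and3P[u'v xu' xv']; apply/eqP/negPn/negP=> ne.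
case/negP: xv; apply: (@conn_trans _ u'); last first.
  apply: conn_adjacent; rewrite adjacent_link u'v; apply/negP=> /eqP/setP/(_ u).
  by rewrite !inE eqxx (negPf ne) (negPf (adjacent_neq uv)).
apply: conn_transfer xu' => a b xa ab.
have av : a != v by apply: contraNneq xv' => E; move: xa; rewrite E.
have bv : b != v.
  by apply: contraNneq xv' => E; have := conn_trans xa (conn_adjacent ab); rewrite E.
move: ab; rewrite !adjacent_link => /andP[-> _]; apply/negP=> /eqP/setP/(_ v).
by rewrite !inE eqxx orbT eq_sym (negPf av) eq_sym (negPf bv).
Qed.

Lemma sum_bridge_to G x v :
  (\sum_u bridge_to G x u v <= (v != x) && conn G x v)%N.
Proof.
have [/existsP[u hu]|/existsPn h] := boolP [exists u, bridge_to G x u v]; last first.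
  by rewrite big1 // => u _; apply/eqP; rewrite eqb0; apply: h.
rewrite (bigD1 u) //= hu big1 ?addn0 => [|u' ne]; last first.
  by apply/eqP; rewrite eqb0; apply: contra ne => /bridge_to_uniq/(_ hu) ->.
case/and3P: hu => uv xu xv; rewrite lt0b; apply/andP; split.
  by apply: contraNneq xv => ->; apply: conn_refl.
by apply: conn_trans (connS _ xu) (conn_adjacent uv); rewrite subsetDl.
Qed.

(** Each component is counted once by each of its vertices, so the susceptibility is the mean
    cluster size of a uniform vertex. *)
Lemma susceptibilityE (R : realType) G :
  susceptibility R G = n%:R^-1 * \sum_x #|cluster G x|%:R.
Proof.
congr (_ * _); rewrite -natr_sum -natr_sum; congr _%:R.
rewrite [in RHS](eq_bigl (fun x => x \in [set: 'I_n])); last by move=> x; rewrite inE.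
have pP := components_partition G; have [_ tP _] := and3P pP.
rewrite (set_partition_big _ pP) /=; apply: eq_bigr => C CP.
rewrite -mulnn -sum_nat_const; apply: eq_bigr => x xC.
rewrite -(def_pblock tP CP xC); apply: eq_card => y; rewrite inE.
rewrite pblock_equivalence_partition ?inE // => a b c _ _ _; split.
  exact: connect0.
by move=> ab; apply: (same_connect (connC G)) ab c.
Qed.

End Graph.

(** * Expectation under the product measure, independence and disjoint clusters *)

Section Expectation.
Variables (R : realType) (n : nat) (p : R).
Implicit Types (G H K D S : graph n) (x y z u v w : 'I_n) (X Y : graph n -> R).

Local Notation E := (@gnp_E R n p).

Lemma eq_gnp_E X Y : X =1 Y -> E X = E Y.
Proof. by move=> XY; apply: eq_bigr => G _; rewrite XY. Qed.

Lemma gnp_ED X Y : E (fun G => X G + Y G) = E X + E Y.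
Proof. by rewrite /gnp_E -big_split; apply: eq_bigr => G _; rewrite mulrDr. Qed.

Lemma gnp_EZ c X : E (fun G => c * X G) = c * E X.
Proof. by rewrite /gnp_E mulr_sumr; apply: eq_bigr => G _; rewrite mulrCA. Qed.

Lemma gnp_E_sum (I : finType) (P : pred I) (X : I -> graph n -> R) :
  E (fun G => \sum_(i | P i) X i G) = \sum_(i | P i) E (X i).
Proof.
rewrite /gnp_E exchange_big; apply: eq_bigr => G _; exact: mulr_sumr.
Qed.

Lemma gnp_E_cst c : E (fun=> c) = c.
Proof. by rewrite /gnp_E -mulr_suml gnp_sum1 mul1r. Qed.

Lemma gnp_E_mul X Y :
  E X * E Y = \sum_(G : graph n) \sum_(H : graph n) gnp p G * gnp p H * (X G * Y H).
Proof.
rewrite /gnp_E mulr_suml; apply: eq_bigr => G _.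
by rewrite mulr_sumr; apply: eq_bigr => H _; rewrite mulrACA.
Qed.

Lemma gnp_E_pair1 X : E X = \sum_(G : graph n) \sum_(H : graph n) gnp p G * gnp p H * X G.
Proof.
rewrite -[E X]mulr1 -(gnp_E_cst 1) gnp_E_mul.
by do 2!apply: eq_bigr => ? _; rewrite mulr1.
Qed.

Definition splice S G H : graph n := (G :&: S) :|: (H :\: S).

Lemma in_splice S G H e : (e \in splice S G H) = if e \in S then e \in G else e \in H.
Proof. by rewrite !inE; case: (e \in S); rewrite ?andbT ?andbF ?orbF. Qed.

Lemma gnp_splice S G H :
  gnp p (splice S G H) * gnp p (splice S H G) = gnp p G * gnp p H.
Proof.
rewrite /gnp -!big_split; apply: eq_bigr => e _ /=; rewrite !in_splice.
by case: (e \in S); rewrite // mulrC.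
Qed.

Lemma spliceK S G H : splice S (splice S G H) (splice S H G) = G.
Proof. by apply/setP=> e; rewrite !in_splice; case: (e \in S). Qed.

Lemma splice_setI S G H : splice S G H :&: S = G :&: S.
Proof. by apply/setP=> e; rewrite inE in_splice inE; case: (e \in S); rewrite ?andbF. Qed.

Lemma splice_setD S G H : splice S G H :\: S = H :\: S.
Proof. by apply/setP=> e; rewrite inE in_splice inE; case: (e \in S). Qed.

(** The set of edges kept may depend on the first graph, as long as the swap does not change it:
    exchanging the rest is then an involution on pairs, and it preserves the product weight. *)
Lemma gnp_swap (S : graph n -> graph n) (F : graph n -> graph n -> R) :
    (forall G H, S (splice (S G) G H) = S G) ->
  \sum_(G : graph n) \sum_(H : graph n) gnp p G * gnp p H * F G H =
  \sum_(G : graph n) \sum_(H : graph n)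
    gnp p G * gnp p H * F (splice (S G) G H) (splice (S G) H G).
Proof.
move=> SE; rewrite !pair_bigA /=.
pose s (q : graph n * graph n) := (splice (S q.1) q.1 q.2, splice (S q.1) q.2 q.1).
have sK : involutive s by case=> G H; rewrite /s /= SE !spliceK.
by rewrite (reindex_inj (inv_inj sK)); apply: eq_bigr => -[G H] _ /=; rewrite gnp_splice.
Qed.

Lemma gnp_E_indep S X Y :
  E (fun G => X (G :&: S) * Y (G :\: S)) =
  E (fun G => X (G :&: S)) * E (fun G => Y (G :\: S)).
Proof.
rewrite gnp_E_mul gnp_E_pair1 (@gnp_swap (fun=> S)) //.
by do 2!apply: eq_bigr => ? _; rewrite splice_setI splice_setD.
Qed.

Lemma gnp_E_adjacent u v : E (fun G => (adjacent G u v)%:R) = p *+ (u != v).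
Proof.
have [<-|uv] := eqVneq u v.
  rewrite mulr0n -(gnp_E_cst 0); apply: eq_gnp_E => G.
  by apply/eqP; rewrite pnatr_eq0 eqb0; apply/negP=> /adjacent_neq; rewrite eqxx.
have [e ee] := adjacent_edge uv; rewrite mulr1n.
rewrite -[RHS]expr1 -[X in p ^+ X](cards1 e) -gnp_edges /gnp_E /gnp_Pr [RHS]big_mkcond.
apply: eq_bigr => G _; rewrite sub1set.
have -> : adjacent G u v = (e \in G).
  apply/adjacentP/idP => [[e' eG' ee']|eG]; last by exists e.
  by rewrite (_ : e = e') //; apply: val_inj; rewrite ee ee'.
by case: (e \in G); rewrite ?mulr1 ?mulr0.
Qed.

Lemma gnp_E_link u v X :
  E (fun G => (adjacent G u v)%:R * X (G :\: link u v)) =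
  p *+ (u != v) * E (fun G => X (G :\: link u v)).
Proof.
rewrite -gnp_E_adjacent.
transitivity (E (fun G => (adjacent (G :&: link u v) u v)%:R * X (G :\: link u v))).
  by apply: eq_gnp_E => G; rewrite adjacent_setI.
rewrite (gnp_E_indep (link u v) (fun G => (adjacent G u v)%:R)); congr (_ * _).
by apply: eq_gnp_E => G; rewrite adjacent_setI.
Qed.

Hypothesis p01 : 0 <= p <= 1.

Lemma ler_gnp_E X Y : (forall G, X G <= Y G) -> E X <= E Y.
Proof. by move=> XY; apply: ler_sum => G _; apply: ler_wpM2l (XY G); apply: gnp_ge0. Qed.

Lemma gnp_E_ge0 X : (forall G, 0 <= X G) -> 0 <= E X.
Proof. by move=> X0; rewrite -(gnp_E_cst 0); apply: ler_gnp_E. Qed.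

Lemma gnp_Pr_E (A : pred (graph n)) : gnp_Pr p A = E (fun G => (A G)%:R).
Proof.
rewrite /gnp_Pr big_mkcond; apply: eq_bigr => G _.
by case: (A G); rewrite ?mulr1 ?mulr0.
Qed.

(* A form of the van den Berg-Kesten inequality: swapping, between two
   independent graphs, the edges which meet the cluster of [x] in the first one
   preserves both the law of the pair and that cluster. *)
Lemma gnp_E_disjoint_clusters D x z (phi psi : {set 'I_n} -> R) :
    (forall A, 0 <= phi A) -> (forall A, 0 <= psi A) ->
    (forall A B : {set 'I_n}, A \subset B -> psi A <= psi B) ->
  E (fun G => (~~ conn (G :\: D) x z)%:R *
              (phi (cluster (G :\: D) x) * psi (cluster (G :\: D) z))) <=
  E (fun G => phi (cluster (G :\: D) x)) * E (fun G => psi (cluster (G :\: D) z)).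
Proof.
move=> phi0 psi0 psiS.
pose S G : graph n := [set e : edge n | ~~ [disjoint val e & cluster (G :\: D) x]].
have clS G H : cluster (splice (S G) G H :\: D) x = cluster (G :\: D) x.
  apply: eq_cluster => e he; have eS : e \in S G by rewrite inE.
  by rewrite !in_setD in_splice eS.
rewrite gnp_E_mul gnp_E_pair1 (@gnp_swap S); last by move=> G H; rewrite /S clS.
apply: ler_sum => G _; apply: ler_sum => H _.
apply: ler_wpM2l; first by apply: mulr_ge0; apply: gnp_ge0.
rewrite clS; case: (boolP (conn _ x z)) => /= xz.
  by rewrite mul0r mulr_ge0.
rewrite mul1r; apply: ler_wpM2l => //; apply: psiS.
(* The cluster of [z] in [K] avoids that of [x], so all its edges lie outside [S G] and come from
   [H]. *)
set K := splice (S G) G H in xz *.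
apply/subsetP=> y; rewrite !in_cluster; apply: conn_transfer => a b za.
have nb c : conn (K :\: D) z c -> c \notin cluster (G :\: D) x.
  move=> zc; apply: contra xz => xc; rewrite connC; apply: conn_trans zc _.
  by rewrite connC -in_cluster clS.
move=> ab; have zb := conn_trans za (conn_adjacent ab).
case/adjacentP: ab => e eK ee; apply/adjacentP; exists e => //.
move: eK; rewrite !inE ee => /andP[-> /=].
have -> : [disjoint [set a; b] & cluster (G :\: D) x].
  apply/pred0P=> c /=; rewrite !inE; apply/negP=> /andP[/orP[]/eqP ->].
    by apply/negP; rewrite -in_cluster nb.
  by apply/negP; rewrite -in_cluster nb.
by rewrite andbF.
Qed.

End Expectation.

(** Monotone coupling: keeping each edge of a $G(n,q)$ graph independently with probability
    [r = p / q] produces a $G(n,p)$ subgraph. *)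
Lemma ler_gnp_E_prob (R : realType) (n : nat) (p q : R) (X : graph n -> R) :
    0 <= p -> p <= q -> q <= 1 ->
    (forall G H : graph n, G \subset H -> X G <= X H) ->
  gnp_E p X <= gnp_E q X.
Proof.
move=> p0 pq q1 XS; have q0 := le_trans p0 pq.
have [qz|qn0] := eqVneq q 0; first by rewrite (le_anti (_ : p <= q <= p)) // pq qz.
pose r := p / q.
have r0 : 0 <= r by rewrite divr_ge0.
have r1 : 0 <= 1 - r by rewrite subr_ge0 ler_pdivrMr ?mul1r // lt_def qn0.
have qr : q * r = p by rewrite mulrC divfK.
(* The joint law of the coupled pair; it vanishes unless [G] is contained in [K]. *)
pose m (K G : graph n) : R := \prod_e (if e \in K then
  (if e \in G then q * r else q * (1 - r)) else (if e \in G then 0 else 1 - q)).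
have m0 K G : 0 <= m K G.
  have q1' : 0 <= 1 - q by rewrite subr_ge0.
  by apply: prodr_ge0 => e _; case: (e \in K); case: (e \in G) => //; apply: mulr_ge0.
have mG G : \sum_K m K G = gnp p G.
  rewrite -(bigA_distr _ _ (fun e => if e \in G then q * r else q * (1 - r))
    (fun e => if e \in G then 0 else 1 - q)) /gnp.
  by apply: eq_bigr => e _; case: ifP => _ /=; rewrite -qr; ring.
have mK K : \sum_G m K G = gnp q K.
  transitivity (\sum_(G : graph n) \prod_e (if e \in G then
      (if e \in K then q * r else 0) else (if e \in K then q * (1 - r) else 1 - q))).
    by apply: eq_bigr => G _; apply: eq_bigr => e _; do 2!case: ifP.
  rewrite -(bigA_distr _ _ (fun e => if e \in K then q * r else 0)
    (fun e => if e \in K then q * (1 - r) else 1 - q)) /gnp.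
  by apply: eq_bigr => e _; case: ifP => _ /=; ring.
rewrite /gnp_E (eq_bigr (fun G => \sum_K m K G * X G)); last first.
  by move=> G _; rewrite -mG mulr_suml.
rewrite [leRHS](eq_bigr (fun K => \sum_G m K G * X K)); last first.
  by move=> G _; rewrite -mK mulr_suml.
rewrite exchange_big; apply: ler_sum => K _; apply: ler_sum => G _.
have [GK|/subsetPn[e eG eK]] := boolP (G \subset K).
  by rewrite ler_wpM2l // XS.
by rewrite /m (bigD1 e) //= (negPf eK) eG !mul0r.
Qed.

(** * Recursive inequalities for the moments of the cluster size *)

Section Moments.
Variables (R : realType) (n : nat) (p : R).
Hypothesis p01 : 0 <= p <= 1.
Implicit Types (G : graph n) (x y z u v w : 'I_n).

Local Notation E := (@gnp_E R n p).

Definition csize G x : R := #|cluster G x|%:R.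

(** The number of vertices gained by the cluster of [x] when an edge joins it to [v]; hence 0 if [v]
    already belongs to it. *)
Definition far_size G x v : R := if conn G x v then 0 else csize G v.

Definition moment k x : R := E (fun G => csize G x ^+ k).

Lemma csizeE G x : csize G x = \sum_v (conn G x v)%:R.
Proof.
rewrite /csize -sum1_card natr_sum big_mkcond; apply: eq_bigr => v _.
by rewrite in_cluster; case: conn.
Qed.

Lemma csize_ge1 G x : 1 <= csize G x.
Proof. by rewrite ler1n cluster_gt0. Qed.

Lemma csize_ge0 G x : 0 <= csize G x. Proof. exact: ler0n. Qed.

Lemma far_size_ge0 G x v : 0 <= far_size G x v.
Proof. by rewrite /far_size; case: ifP => // _; apply: csize_ge0. Qed.

Lemma moment_ge0 k x : 0 <= moment k x.
Proof. by apply: gnp_E_ge0 => // G; rewrite exprn_ge0 ?csize_ge0. Qed.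

Let p0 : 0 <= p. Proof. by case/andP: p01. Qed.

Lemma ler_csizeS G (H : graph n) x : G \subset H -> csize G x <= csize H x.
Proof. by move=> GH; rewrite ler_nat subset_leq_card ?clusterS. Qed.

(** One of the [k.+1] factors is expanded as a sum over the vertices [v] of the cluster. The term
    [v = x] gives [moment k x]; any other [v] has a last edge [uv], which is independent of the
    graph without it, and the cluster there bounds the remaining [k] factors. *)
Lemma moment_rec k x :
  moment k.+1 x <= moment k x + \sum_v \sum_u p * E (fun G =>
    (conn (G :\: link u v) x u)%:R *
    (csize (G :\: link u v) x + far_size (G :\: link u v) x v) ^+ k).
Proof.
pose f u v G := (adjacent G u v)%:R * ((conn (G :\: link u v) x u)%:R *
    (csize (G :\: link u v) x + far_size (G :\: link u v) x v) ^+ k).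
have f0 u v G : 0 <= f u v G.
  by rewrite !mulr_ge0 ?ler0n // exprn_ge0 // addr_ge0 ?csize_ge0 ?far_size_ge0.
apply: (@le_trans _ _ (moment k x + \sum_v \sum_u E (f u v))); last first.
  rewrite lerD2l; apply: ler_sum => v _; apply: ler_sum => u _.
  rewrite /f (gnp_E_link p u v (fun G => (conn G x u)%:R *
    (csize G x + far_size G x v) ^+ k)).
  case: (u != v); rewrite ?mulr1n ?mulr0n ?mul0r //; apply: mulr_ge0 => //.
  apply: gnp_E_ge0 => // G.
  by rewrite mulr_ge0 ?ler0n // exprn_ge0 // addr_ge0 ?csize_ge0 ?far_size_ge0.
under [X in _ <= _ + X]eq_bigr do rewrite -gnp_E_sum.
rewrite -gnp_E_sum -gnp_ED; apply: ler_gnp_E => // G.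
rewrite exprS {1}csizeE mulr_suml (bigD1 x) //= conn_refl mul1r lerD2l.
rewrite [leRHS](bigD1 x) //= -[leLHS]add0r; apply: lerD.
  by apply: sumr_ge0 => u _; apply: f0.
apply: ler_sum => v vx; case: (boolP (conn G x v)) => xv; last first.
  by rewrite mul0r; apply: sumr_ge0 => u _; apply: f0.
have [u uv xu] := conn_last_edge vx xv.
rewrite (bigD1 u) //= /f uv xu !mul1r -[leLHS]addr0; apply: lerD; last first.
  by apply: sumr_ge0 => w _; apply: f0.
apply: lerXn2r; rewrite ?nnegrE ?csize_ge0 ?addr_ge0 ?csize_ge0 ?far_size_ge0 //.
have := card_cluster_link xu; rewrite -(ler_nat R) natrD => /le_trans; apply.
by rewrite /far_size; case: ifP.
Qed.

Lemma sum_conn_moment k x :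
  \sum_u E (fun G => (conn G x u)%:R * csize G x ^+ k) = moment k.+1 x.
Proof.
rewrite -gnp_E_sum; apply: eq_gnp_E => G.
by rewrite -mulr_suml -csizeE exprS.
Qed.

(** Restoring the deleted edge only enlarges the cluster; the sum over [u] then supplies one more
    factor and the sum over [v] a factor [n]. *)
Lemma near_terms k x :
  \sum_v \sum_u p * E (fun G =>
    (conn (G :\: link u v) x u)%:R * csize (G :\: link u v) x ^+ k) <=
  n%:R * p * moment k.+1 x.
Proof.
have -> : n%:R * p * moment k.+1 x = \sum_(v < n) p * moment k.+1 x.
  by rewrite sumr_const card_ord -mulrA mulr_natl.
apply: ler_sum => v _; rewrite -mulr_sumr; apply: ler_wpM2l => //.
rewrite -sum_conn_moment; apply: ler_sum => u _; apply: ler_gnp_E => // G.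
have s : G :\: link u v \subset G by rewrite subsetDl.
apply: ler_pM; rewrite ?exprn_ge0 ?csize_ge0 //.
  by rewrite ler_nat; case: (boolP (conn _ _ _)) => // /(connS s) ->.
by apply: lerXn2r; rewrite ?nnegrE ?csize_ge0 ?ler_csizeS.
Qed.

(** The clusters of [x] and [v] after deletion are disjoint whenever the term is nonzero, so its
    expectation is at most a product. *)
Lemma far_terms (b : R) i j x : (forall v, moment j.+1 v <= b) ->
  \sum_v \sum_u p * E (fun G => (conn (G :\: link u v) x u)%:R *
    (csize (G :\: link u v) x ^+ i * far_size (G :\: link u v) x v ^+ j.+1)) <=
  n%:R * p * (moment i.+1 x * b).
Proof.
move=> hb.
have -> : n%:R * p * (moment i.+1 x * b) = \sum_(v < n) p * (moment i.+1 x * b).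
  by rewrite sumr_const card_ord -mulrA mulr_natl.
apply: ler_sum => v _; rewrite -mulr_sumr; apply: ler_wpM2l => //.
apply: (@le_trans _ _ (moment i.+1 x * moment j.+1 v)); last first.
  by apply: ler_wpM2l; rewrite ?moment_ge0.
rewrite -sum_conn_moment mulr_suml; apply: ler_sum => u _.
pose phi (A : {set 'I_n}) : R := (u \in A)%:R * #|A|%:R ^+ i.
pose psi (A : {set 'I_n}) : R := #|A|%:R ^+ j.+1.
have phi0 A : 0 <= phi A by rewrite mulr_ge0 ?exprn_ge0 ?ler0n.
have psi0 A : 0 <= psi A by rewrite exprn_ge0 ?ler0n.
have psiS (A B : {set 'I_n}) : A \subset B -> psi A <= psi B.
  by move=> AB; apply: lerXn2r; rewrite ?nnegrE ?ler0n // ler_nat subset_leq_card.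
have := gnp_E_disjoint_clusters p01 (link u v) x v phi0 psi0 psiS.
move=> h; apply: le_trans (le_trans h _).
  rewrite le_eqVlt; apply/orP; left; apply/eqP/eq_gnp_E => G.
  rewrite /phi /psi in_cluster /far_size /csize.
  (* The exponent [j.+1] is positive, so the value 0 of [far_size] kills the connected case. *)
  by case: (conn _ x v); rewrite /= ?expr0n ?mulr0 ?mul0r ?mul1r ?mulrA.
have s G : G :\: link u v \subset G by rewrite subsetDl.
apply: ler_pM; rewrite ?gnp_E_ge0 //; apply: ler_gnp_E => // G.
  rewrite /phi in_cluster; apply: ler_pM; rewrite ?exprn_ge0 ?ler0n //.
    by rewrite ler_nat; case: (boolP (conn _ _ _)) => // /(connS (s G)) ->.
  by apply: lerXn2r; rewrite ?nnegrE ?ler0n //; apply: ler_csizeS.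
by apply: psiS; apply: clusterS.
Qed.

Lemma moment0 x : moment 0 x = 1.
Proof. by rewrite -[RHS](@gnp_E_cst R n p). Qed.

Lemma moment1_rec x : moment 1 x <= 1 + n%:R * p * moment 1 x.
Proof.
apply: le_trans (moment_rec 0 x) _; rewrite moment0 lerD2l.
exact: le_trans (near_terms 0 x).
Qed.

Lemma moment2_rec (b1 : R) x : (forall v, moment 1 v <= b1) ->
  moment 2 x <= moment 1 x + n%:R * p * (moment 2 x + moment 1 x * b1).
Proof.
move=> h1; apply: le_trans (moment_rec 1 x) _; rewrite lerD2l mulrDr.
apply: le_trans (lerD (near_terms 1 x) (far_terms 0 x h1)).
rewrite -big_split /= le_eqVlt; apply/orP; left; apply/eqP; apply: eq_bigr => v _.
rewrite -big_split /=; apply: eq_bigr => u _.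
rewrite -mulrDr -gnp_ED; congr (_ * _); apply: eq_gnp_E => G.
by rewrite -mulrDr expr0 mul1r !expr1.
Qed.

Lemma moment3_rec (b1 b2 : R) x :
    (forall v, moment 1 v <= b1) -> (forall v, moment 2 v <= b2) ->
  moment 3 x <= moment 2 x +
    n%:R * p * (moment 3 x + 2 * (moment 2 x * b1) + moment 1 x * b2).
Proof.
move=> h1 h2; apply: le_trans (moment_rec 2 x) _; rewrite lerD2l.
rewrite mulr2n mulrDl mul1r !mulrDr.
(* The cross term of the expanded square; it occurs twice. *)
have F := far_terms 1 x h1.
apply: le_trans (lerD (lerD (near_terms 2 x) (lerD F F)) (far_terms 0 x h2)).
rewrite -!big_split /= le_eqVlt; apply/orP; left; apply/eqP; apply: eq_bigr => v _.
rewrite -!big_split /=; apply: eq_bigr => u _.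
rewrite -!mulrDr -!gnp_ED; congr (_ * _); apply: eq_gnp_E => G.
by ring.
Qed.

(** Besides [x] itself, only those [v] are counted that are separated from [x] by a bridge ending at
    [v]. Such a bridge is unique, and the pairs [u], [v] with [u] inside and [v] outside a cluster
    of size c number c (n - c). *)
Lemma moment1_lower x : 1 - p * moment 2 x <= (1 - n%:R * p) * moment 1 x.
Proof.
suff h : 1 + (p * n%:R * moment 1 x - p * moment 2 x) <= moment 1 x by lra.
pose f u v G : R := (adjacent G u v)%:R *
  ((conn (G :\: link u v) x u)%:R * (~~ conn (G :\: link u v) x v)%:R).
pose g u v G : R := (conn G x u)%:R * (~~ conn G x v)%:R.
apply: (@le_trans _ _ (1 + \sum_v \sum_u E (f u v))); last first.
  under [X in _ + X]eq_bigr do rewrite -gnp_E_sum.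
  rewrite -gnp_E_sum -{1}(@gnp_E_cst R n p 1) -gnp_ED; apply: ler_gnp_E => // G.
  rewrite expr1 csizeE [leRHS](bigD1 x) //= conn_refl lerD2l [leLHS](bigD1 x) //=.
  rewrite big1 ?add0r => [|u _]; last by rewrite /f conn_refl !mulr0.
  apply: ler_sum => v vx; have := sum_bridge_to G x v.
  rewrite vx /= -(ler_nat R) natr_sum; apply: le_trans; apply: ler_sum => u _.
  by rewrite /f /bridge_to; case: (adjacent _ _ _); case: (conn _ _ u);
    case: (conn _ _ v); rewrite /= ?(mulr0, mul0r, mulr1).
rewrite lerD2l.
apply: (@le_trans _ _ (\sum_v \sum_u p * E (g u v))); last first.
  apply: ler_sum => v _; apply: ler_sum => u _.
  rewrite /f (gnp_E_link p u v (fun G => (conn G x u)%:R * (~~ conn G x v)%:R)).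
  have [->|uv] := eqVneq u v.
    rewrite mulr0n mul0r (@eq_gnp_E _ _ _ (g v v) (fun=> 0)) ?gnp_E_cst ?mulr0 // => G.
    by rewrite /g; case: (conn _ _ _); rewrite ?mul0r ?mulr0.
  rewrite mulr1n; apply: ler_wpM2l => //; apply: ler_gnp_E => // G; rewrite /g.
  case: (boolP (conn G x u)) => xu; last by rewrite mul0r mulr_ge0.
  case: (boolP (conn G x v)) => xv; first by rewrite mulr0 mulr_ge0.
  (* The edge [uv] is absent from [G], as it would connect [x] to [v]. *)
  have -> : G :\: link u v = G; last by rewrite xu xv.
  apply/setDidPl; rewrite disjoints_subset; apply/subsetP=> e eG; rewrite !inE.
  apply: contra xv => /eqP ee; apply: conn_trans xu _; apply: conn_adjacent.
  by apply/adjacentP; exists e.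
under eq_bigr do rewrite -mulr_sumr -gnp_E_sum.
rewrite -mulr_sumr -gnp_E_sum -mulrA -mulrBr; apply: ler_wpM2l => //.
rewrite -[X in X - _]gnp_EZ -mulN1r -[X in _ + X]gnp_EZ -gnp_ED.
apply: ler_gnp_E => // G; rewrite le_eqVlt; apply/orP; left; apply/eqP.
rewrite /g exchange_big /=; under eq_bigr do rewrite -mulr_sumr.
rewrite -mulr_suml -csizeE.
have -> : \sum_i (~~ conn G x i)%:R = n%:R - csize G x :> R.
  have -> : n%:R = \sum_(i < n) 1 :> R by rewrite sumr_const card_ord.
  rewrite csizeE -sumrB.
  by apply: eq_bigr => i _; case: (conn _ _ _); rewrite /= ?subrr ?subr0.
by ring.
Qed.

Lemma moment1_ge1 x : 1 <= moment 1 x.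
Proof.
by rewrite -(@gnp_E_cst R n p 1); apply: ler_gnp_E => // G; rewrite expr1 csize_ge1.
Qed.

End Moments.

(** * Moment bounds for np < 1, with b = 1 / (1 - np) *)

Section Subcritical.
Variables (R : realType) (n : nat) (p b : R).
Hypothesis p01 : 0 <= p <= 1.
Hypothesis b_ge0 : 0 <= b.
Hypothesis bE : b * (1 - n%:R * p) = 1.
Implicit Types (G : graph n) (x : 'I_n).

Let l_ge0 : 0 <= n%:R * p.
Proof. by case/andP: p01 => p0 _; rewrite mulr_ge0 ?ler0n. Qed.

Lemma le_of_recursion (m a : R) : m <= a + n%:R * p * m -> m <= b * a.
Proof.
move=> h; have : b * ((1 - n%:R * p) * m) <= b * a by apply: ler_wpM2l => //; lra.
by rewrite mulrA bE mul1r.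
Qed.

Lemma inverse_gap_rec : b = 1 + n%:R * p * b.
Proof. by transitivity (b * (1 - n%:R * p) + n%:R * p * b); [ring | rewrite bE]. Qed.

Lemma moment1_le x : moment p 1 x <= b.
Proof. by rewrite -[b]mulr1; apply/le_of_recursion/moment1_rec. Qed.

(** With [moment p 1 x] at most [b], the terms free of the second moment add up to b + np b^2, which
    is exactly b^2; solving the recursion gives one more factor [b]. *)
Lemma moment2_le x : moment p 2 x <= b ^+ 3.
Proof.
rewrite exprS; apply: le_of_recursion.
apply: le_trans (moment2_rec p01 x moment1_le) _.
have -> : b ^+ 2 = b + n%:R * p * (b * b) by rewrite expr2 {1}inverse_gap_rec; ring.
have h : moment p 1 x * b <= b * b by apply: ler_wpM2r (moment1_le x).
have {}h : n%:R * p * (moment p 1 x * b) <= n%:R * p * (b * b) by apply: ler_wpM2l.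
by have := moment1_le x; rewrite mulrDr; lra.
Qed.

Lemma moment3_le x : moment p 3 x <= 3 * b ^+ 5.
Proof.
have -> : 3 * b ^+ 5 = b * (3 * b ^+ 4) by ring.
apply: le_of_recursion.
apply: le_trans (moment3_rec p01 x moment1_le moment2_le) _.
have h1 : moment p 2 x * b <= b ^+ 3 * b by apply: ler_wpM2r (moment2_le x).
have h2 : moment p 1 x * b ^+ 3 <= b * b ^+ 3.
  by apply: ler_wpM2r (moment1_le x); rewrite exprn_ge0.
have h3 := moment2_le x.
have h4 : n%:R * p * (moment p 3 x + 2 * (moment p 2 x * b) + moment p 1 x * b ^+ 3)
   <= n%:R * p * (moment p 3 x + 3 * b ^+ 4).
  apply: ler_wpM2l => //.
  rewrite (_ : 3 * b ^+ 4 = 2 * (b ^+ 3 * b) + b * b ^+ 3); last by ring.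
  by lra.
have h5 : b ^+ 3 + n%:R * p * b * b ^+ 3 = b ^+ 4.
  by transitivity ((1 + n%:R * p * b) * b ^+ 3); [ring | rewrite -inverse_gap_rec; ring].
have h6 : 0 <= b ^+ 3 by rewrite exprn_ge0.
(* Since np b^4 = b^4 - b^3, the left side equals 3 b^4 - 3 b^3; a single b^3 is enough to absorb
   the second moment. *)
have h7 : n%:R * p * (3 * b ^+ 4) <= 3 * b ^+ 4 - b ^+ 3.
  have -> : n%:R * p * (3 * b ^+ 4) = 3 * (n%:R * p * b * b ^+ 3) by ring.
  by lra.
by lra.
Qed.

Lemma moment1_ge x : b - p * b ^+ 4 <= moment p 1 x.
Proof.
have h := moment1_lower p01 x; have h2 := moment2_le x.
have p0 : 0 <= p by case/andP: p01.
have {}h : b * (1 - p * b ^+ 3) <= b * ((1 - n%:R * p) * moment p 1 x).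
  apply: ler_wpM2l => //; apply: le_trans h; rewrite lerD2l lerN2.
  exact: ler_wpM2l.
move: h; rewrite [leRHS]mulrA bE mul1r; apply: le_trans.
by rewrite le_eqVlt; apply/orP; left; apply/eqP; ring.
Qed.

End Subcritical.

(** * Mean, variance and monotonicity of the susceptibility *)

Section Susceptibility.
Variables (R : realType) (n : nat).
Hypothesis n_gt0 : (0 < n)%N.
Implicit Types (G H : graph n) (x : 'I_n) (p : R).

Local Notation chi := (@susceptibility R n).
Local Notation E p := (@gnp_E R n p).

Let nR : 0 < n%:R :> R. Proof. by rewrite ltr0n. Qed.

Lemma susceptibility_csize G : chi G = n%:R^-1 * \sum_x csize R G x.
Proof. exact: susceptibilityE. Qed.

Lemma susceptibility_ge1 G : 1 <= chi G.
Proof.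
rewrite susceptibility_csize mulrC ler_pdivlMr // mul1r.
rewrite -{1}(card_ord n) -sum1_card natr_sum; apply: ler_sum => x _; exact: csize_ge1.
Qed.

Lemma susceptibility_gt0 G : 0 < chi G.
Proof. exact: lt_le_trans ltr01 (susceptibility_ge1 G). Qed.

Lemma ler_susceptibility G H : G \subset H -> chi G <= chi H.
Proof.
move=> GH; rewrite !susceptibility_csize; apply: ler_wpM2l; first by rewrite invr_ge0 ltW.
by apply: ler_sum => x _; apply: ler_csizeS.
Qed.

Lemma gnp_E_susceptibility p : E p chi = n%:R^-1 * \sum_(x < n) moment p 1 x.
Proof.
rewrite -gnp_E_sum -gnp_EZ; apply: eq_gnp_E => G; rewrite susceptibility_csize.
by congr (_ * _); apply: eq_bigr => x _; rewrite expr1.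
Qed.

Lemma gnp_E_susceptibility_ge p (a : R) :
  (forall x : 'I_n, a <= moment p 1 x) -> a <= E p chi.
Proof.
move=> h; rewrite gnp_E_susceptibility mulrC ler_pdivlMr // mulrC mulr_natl.
by rewrite -[X in a *+ X]card_ord -sumr_const; apply: ler_sum.
Qed.

Lemma gnp_E_susceptibility_le p (a : R) :
  (forall x : 'I_n, moment p 1 x <= a) -> E p chi <= a.
Proof.
move=> h; rewrite gnp_E_susceptibility mulrC ler_pdivrMr // mulrC mulr_natl.
by rewrite -[X in a *+ X]card_ord -sumr_const; apply: ler_sum.
Qed.

(** The square is a double sum over [x] and [z]. Connected pairs have equal clusters and sum to the
    third moment; for the others, the disjoint-cluster inequality with no edge deleted bounds the
    expectation by the product of the means. *)
Lemma gnp_E_susceptibility_sqr p (a : R) : 0 <= p <= 1 ->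
  (forall x : 'I_n, moment p 3 x <= a) ->
  E p (fun G => chi G ^+ 2) <= E p chi ^+ 2 + n%:R^-1 * a.
Proof.
move=> p01 h; rewrite gnp_E_susceptibility.
have -> : n%:R^-1 * a = n%:R^-1 ^+ 2 * \sum_(x < n) a.
  by rewrite sumr_const card_ord -mulr_natl; field; rewrite gt_eqF.
rewrite exprMn -mulrDr; under eq_gnp_E do rewrite susceptibility_csize exprMn.
rewrite gnp_EZ; apply: ler_wpM2l; first by rewrite exprn_ge0 ?invr_ge0 ?ltW.
rewrite expr2 mulr_suml -big_split /=.
under eq_gnp_E do rewrite expr2 mulr_suml.
rewrite gnp_E_sum; apply: ler_sum => x _.
under eq_gnp_E do rewrite mulr_sumr.
apply: le_trans (lerD (lexx _) (h x)); rewrite gnp_E_sum mulr_sumr.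
have -> : moment p 3 x =
    \sum_z E p (fun G => (conn G x z)%:R * (csize R G x * csize R G z)).
  rewrite -gnp_E_sum; apply: eq_gnp_E => G; rewrite 2!exprS expr1 {1}csizeE mulr_suml.
  apply: eq_bigr => z _; case: (boolP (conn G x z)) => xz; last by rewrite !mul0r.
  congr (_ * (_ * _)); rewrite /csize; congr _%:R; apply: eq_card => y.
  by rewrite !in_cluster; apply: (same_connect (connC G)) xz y.
rewrite -big_split /=; apply: ler_sum => z _.
pose phi (A : {set 'I_n}) : R := #|A|%:R.
have phi0 A : 0 <= phi A by rewrite ler0n.
have phiS (A B : {set 'I_n}) : A \subset B -> phi A <= phi B.
  by move=> AB; rewrite ler_nat subset_leq_card.
have := gnp_E_disjoint_clusters p01 set0 x z phi0 phi0 phiS.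
have D0 F : E p (fun G => F (G :\: set0)) = E p F.
  by apply: eq_gnp_E => G; rewrite setD0.
rewrite (D0 (fun G => (~~ conn G x z)%:R * (phi (cluster G x) * phi (cluster G z)))).
rewrite (D0 (fun G => phi (cluster G x))) (D0 (fun G => phi (cluster G z))).
move=> d; apply: le_trans (lerD d (lexx _)); rewrite -gnp_ED le_eqVlt; apply/orP; left.
apply/eqP/eq_gnp_E => G; rewrite -mulrDl.
by case: (conn _ _ _); rewrite /= ?addr0 ?add0r ?mul1r.
Qed.

Lemma ler_gnp_Pr p (P Q : pred (graph n)) : 0 <= p <= 1 ->
  (forall G, P G -> Q G) -> gnp_Pr p P <= gnp_Pr p Q.
Proof.
move=> p01 PQ; rewrite !gnp_Pr_E; apply: ler_gnp_E => // G; rewrite ler_nat.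
by case: (boolP (P G)) => // /PQ ->.
Qed.

Lemma chebyshev p (X : graph n -> R) (t : R) : 0 <= p <= 1 -> 0 < t ->
  gnp_Pr p (fun G => t <= `|X G - E p X|) <=
  (E p (fun G => X G ^+ 2) - E p X ^+ 2) / t ^+ 2.
Proof.
move=> p01 t0; rewrite gnp_Pr_E; set m := E p X.
have -> : E p (fun G => X G ^+ 2) - m ^+ 2 = E p (fun G => (X G - m) ^+ 2).
  transitivity (E p (fun G => (X G ^+ 2 + (- (2 * m)) * X G) + m ^+ 2)).
    by rewrite !gnp_ED gnp_EZ gnp_E_cst -/m; ring.
  by apply: eq_gnp_E => G; ring.
rewrite mulrC -gnp_EZ; apply: ler_gnp_E => // G.
case: (boolP (t <= _)) => h; last by apply: mulr_ge0; rewrite ?invr_ge0 sqr_ge0.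
rewrite mulrC ler_pdivlMr ?exprn_gt0 // mul1r -[leRHS]real_normK ?num_real //.
by apply: lerXn2r; rewrite ?nnegrE ?normr_ge0 // ltW.
Qed.

Variable s : R.
Hypothesis s_gt0 : 0 < s.
Hypothesis s3 : n%:R * s ^+ 3 = 1.

Let invn : n%:R^-1 = s ^+ 3.
Proof. by apply: (mulfI (lt0r_neq0 nR)); rewrite s3 mulfV ?gt_eqF. Qed.

(** * The range 1 - np >= 4 k s, where s^3 = 1 / n *)

Section Window.
Variables (p k : R).
Hypothesis p01 : 0 <= p <= 1.
Hypothesis k1 : 1 <= k.
Hypothesis window : 4 * k * s <= 1 - n%:R * p.

Let d := 1 - n%:R * p.
Let b := d^-1.
Let d_gt0 : 0 < d.
Proof. by apply: lt_le_trans window; rewrite !mulr_gt0 // (lt_le_trans ltr01). Qed.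
Let b_gt0 : 0 < b. Proof. by rewrite invr_gt0. Qed.
Let bE : b * d = 1. Proof. by rewrite mulVf ?gt_eqF. Qed.
(** The ratio of the scale [s] to the gap [d]. It measures the relative errors, and the window
    amounts to [k * y <= 1 / 4]. *)
Let y := s * b.
Let y_gt0 : 0 < y. Proof. exact: mulr_gt0. Qed.
Let ky : k * y <= 1 / 4.
Proof.
have : 4 * k * s * b <= d * b by apply: ler_wpM2r (window); apply: ltW.
by rewrite [d * b]mulrC bE /y; lra.
Qed.
Let y4 : y <= 1 / 4.
Proof. by apply: le_trans ky; rewrite ler_peMl // ltW. Qed.
Let p_le : p <= s ^+ 3.
Proof.
rewrite -invn -[n%:R^-1]mul1r ler_pdivlMr // mulrC.
by move: d_gt0; rewrite /d; lra.
Qed.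

Lemma mean_le : E p chi <= b.
Proof. by apply: gnp_E_susceptibility_le => x; apply: moment1_le => //; apply: ltW. Qed.

Lemma mean_ge : b * (1 - y ^+ 3) <= E p chi.
Proof.
apply: gnp_E_susceptibility_ge => x.
apply: le_trans (moment1_ge p01 (ltW b_gt0) bE x).
have -> : b * (1 - y ^+ 3) = b - s ^+ 3 * b ^+ 4 by rewrite /y; ring.
by rewrite lerD2l lerN2; apply: ler_wpM2r p_le; rewrite exprn_ge0 // ltW.
Qed.

Lemma mean_gt0 : 0 < E p chi.
Proof.
apply: lt_le_trans mean_ge; apply: mulr_gt0 => //.
by have := y4; have := y_gt0; rewrite !exprS expr0; nra.
Qed.

Lemma inv_mean_ge : d <= (E p chi)^-1.
Proof. by rewrite -[d]invrK lef_pV2 ?posrE ?mean_gt0 // mean_le. Qed.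

(** By the lower bound on the mean, it suffices that (1 + y) (1 - y^3) >= 1, which holds for y <=
    1/4. *)
Lemma inv_mean_le : (E p chi)^-1 <= d + s.
Proof.
rewrite -[_^-1]mul1r ler_pdivrMr ?mean_gt0 //.
have ds : 0 <= d + s by rewrite addr_ge0 // ltW.
apply: le_trans (ler_wpM2l ds mean_ge).
have -> : (d + s) * (b * (1 - y ^+ 3)) = (b * d + y) * (1 - y ^+ 3) by rewrite /y; ring.
rewrite bE; have h : y ^+ 2 <= 1 / 16.
  by have := y4; have := y_gt0; rewrite expr2; nra.
have h2 : 0 <= y * (1 - y ^+ 2 - y ^+ 2 * y) .
  by apply: mulr_ge0; [exact: ltW | have := y4; have := y_gt0; nra].
by have : (1 + y) * (1 - y ^+ 3) = 1 + y * (1 - y ^+ 2 - y ^+ 2 * y) by [ring]; lra.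
Qed.

(** Chebyshev with deviation k y b: the variance 3 s^3 b^5 over its square is 3 y / k^2. Off this
    event chi is close to [b], and inversion multiplies the error by at most 2 d^2. *)
Lemma inv_susceptibility_window :
  gnp_Pr p (fun G => 3 * k * s < `|(chi G)^-1 - d|) <= 3 / 4 / k.
Proof.
have k0 : 0 < k by apply: lt_le_trans k1.
have t0 : 0 < k * y * b by rewrite !mulr_gt0.
apply: (@le_trans _ _ (gnp_Pr p (fun G => k * y * b <= `|chi G - E p chi|))).
  apply: ler_gnp_Pr => // G; apply: contraTT; rewrite -leNgt -ltNge => h.
  have y3 : y ^+ 3 <= k * y / 16.
    apply: (@le_trans _ _ (y / 16)).
      by have := y4; have := y_gt0; rewrite !exprS expr0; nra.
    by have : y <= k * y by [rewrite ler_peMl // ltW]; lra.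
  have h1 := mean_le; have h2 := mean_ge.
  have h3 : b * y ^+ 3 <= b * (k * y / 16) by apply: ler_wpM2l => //; apply: ltW.
  (* The extra 1/16 accounts for the distance of the mean from [b], at most b y^3. *)
  have h4 : `|chi G - b| <= 17 / 16 * (k * y * b).
    by move: h; rewrite ltr_norml ler_norml => /andP[]; lra.
  have h5 : k * y * b <= 1 / 4 * b by apply: ler_wpM2r ky; apply: ltW.
  have h6 : b / 2 <= chi G by move: h4; rewrite ler_norml => /andP[]; lra.
  have c0 := susceptibility_gt0 G.
  have -> : (chi G)^-1 - d = (b - chi G) * (d / chi G).
    by rewrite -[d]invrK -/b; field; rewrite !gt_eqF.
  have dc : 0 < d / chi G by rewrite divr_gt0.
  rewrite normrM distrC (gtr0_norm dc).
  have h7 : d / chi G <= 2 * d ^+ 2.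
    rewrite ler_pdivrMr //; apply: (@le_trans _ _ (2 * d ^+ 2 * (b / 2))).
      by rewrite (_ : 2 * d ^+ 2 * (b / 2) = b * d * d); [rewrite bE mul1r | field].
    by apply: ler_wpM2l => //; rewrite mulr_ge0 ?sqr_ge0.
  apply: le_trans (ler_pM (normr_ge0 _) (ltW dc) h4 h7) _.
  have -> : 17 / 16 * (k * y * b) * (2 * d ^+ 2) = 17 / 8 * k * s * (b * d) ^+ 2.
    by rewrite /y; field.
  by rewrite bE expr1n mulr1; have : 0 <= k * s by [rewrite mulr_ge0 // ltW]; lra.
apply: le_trans (chebyshev _ p01 t0) _.
rewrite ler_pdivrMr ?exprn_gt0 //.
have := gnp_E_susceptibility_sqr p01 (moment3_le p01 (ltW b_gt0) bE).
rewrite invn => h; apply: (@le_trans _ _ (s ^+ 3 * (3 * b ^+ 5))); first by lra.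
have -> : s ^+ 3 * (3 * b ^+ 5) = 3 * y * (y * b) ^+ 2 by rewrite /y; ring.
have -> : 3 / 4 / k * (k * y * b) ^+ 2 = 3 / 4 * k * (y * b) ^+ 2.
  by field; rewrite gt_eqF.
by apply: ler_wpM2r; rewrite ?sqr_ge0 //; have := y4; have := k1; lra.
Qed.

End Window.

(** The edge probability at the boundary of the window, with which all larger [p] are compared. *)
Lemma window_edge (k : R) : 0 < k -> 4 * k * s <= 1 ->
  exists2 q : R, 0 <= q <= 1 & 1 - n%:R * q = 4 * k * s.
Proof.
move=> k0 h; have ks : 0 <= k * s by rewrite mulr_ge0 // ltW.
exists ((1 - 4 * k * s) / n%:R); last by field; rewrite gt_eqF.
rewrite divr_ge0 ?subr_ge0 ?(ltW nR) //= ler_pdivrMr // mul1r.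
by apply: (@le_trans _ _ 1); rewrite ?ler1n //; lra.
Qed.

Lemma inv_gnp_E_susceptibility p : 0 <= p <= 1 ->
  `|(E p chi)^-1 - Num.max (1 - n%:R * p) 0| <= 5 * s.
Proof.
move=> p01; have m1 q : 0 <= q <= 1 -> 1 <= E q chi.
  by move=> q01; apply: gnp_E_susceptibility_ge => x; apply: moment1_ge1.
have [w|w] := leP (4 * 1 * s) (1 - n%:R * p).
  have h1 := inv_mean_ge p01 (lexx 1) w; have h2 := inv_mean_le p01 (lexx 1) w.
  rewrite max_l; last by apply: le_trans w; rewrite !mulr_ge0 // ltW.
  by rewrite ler_norml; move: s_gt0; lra.
have hm : 0 <= Num.max (1 - n%:R * p) 0 <= 4 * s.
  rewrite le_max lexx orbT /= ge_max; move: s_gt0 w; lra.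
suff : 0 <= (E p chi)^-1 <= 5 * s by rewrite ler_norml; lra.
(* If 4 s > 1 there is no boundary value, but then chi >= 1 already gives the bound. *)
have [w1|w1] := leP (4 * 1 * s) 1; last first.
  have := m1 _ p01; move: (E p chi) => e e1; rewrite invr_ge0 (le_trans ler01) //=.
  by apply: (@le_trans _ _ 1); [rewrite invf_le1 // (lt_le_trans ltr01) | lra].
have [q q01 qE] := window_edge ltr01 w1.
have qp : q <= p.
  rewrite -(ler_pM2l nR); lra.
(* At [q] the gap is 4 s, so the inverse mean is at most 4 s + s; it only decreases from [q] to
   [p]. *)
have := inv_mean_le q01 (lexx 1); rewrite qE => /(_ (lexx _)) h.
rewrite invr_ge0 (le_trans ler01) ?m1 //=.
apply: (@le_trans _ _ (E q chi)^-1); last by lra.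
rewrite lef_pV2 ?posrE ?(lt_le_trans ltr01) ?m1 //.
case/andP: q01 => q0 _; case/andP: p01 => _ p1.
by apply: ler_gnp_E_prob => // G H; apply: ler_susceptibility.
Qed.

Lemma inv_susceptibility p k : 0 <= p <= 1 -> 1 <= k ->
  gnp_Pr p (fun G => 7 * k * s < `|(chi G)^-1 - Num.max (1 - n%:R * p) 0|) <= 3 / 4 / k.
Proof.
move=> p01 k1; have k0 : 0 < k by apply: lt_le_trans k1.
have ks : 0 < k * s by rewrite mulr_gt0.
have [w|w] := leP (4 * k * s) (1 - n%:R * p).
  apply: le_trans (inv_susceptibility_window p01 k1 w); apply: ler_gnp_Pr => // G.
  rewrite max_l; last by apply: le_trans w; lra.
  by apply: le_lt_trans; lra.
have hm : 0 <= Num.max (1 - n%:R * p) 0 <= 4 * k * s.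
  by rewrite le_max lexx orbT /= ge_max; lra.
have c0 G : 0 < (chi G)^-1 by rewrite invr_gt0 susceptibility_gt0.
(* The maximum is at most 4 k s, so only a large inverse susceptibility can cause the deviation. *)
have tail G : 7 * k * s < `|(chi G)^-1 - Num.max (1 - n%:R * p) 0| ->
    7 * k * s < (chi G)^-1.
  by rewrite lter_normr => /orP[]; have := c0 G; lra.
apply: le_trans (ler_gnp_Pr p01 tail) _.
have [w1|w1] := leP (4 * k * s) 1; last first.
  apply: (@le_trans _ _ 0); last by rewrite !divr_ge0 // ltW.
  rewrite /gnp_Pr big_pred0 // => G; apply/negbTE; rewrite -leNgt.
  apply: (@le_trans _ _ 1); last by lra.
  by rewrite invf_le1 ?susceptibility_gt0 ?susceptibility_ge1.
have [q q01 qE] := window_edge k0 w1.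
have qp : q <= p by rewrite -(ler_pM2l nR); lra.
have := inv_susceptibility_window q01 k1; rewrite qE => /(_ (lexx _)) h.
apply: le_trans h; apply: (@le_trans _ _ (gnp_Pr q (fun G => 7 * k * s < (chi G)^-1))).
  (* The event is decreasing in the graph, so monotonicity in the edge probability is applied to
     minus its indicator. *)
  have EN r X : - E r X = E r (fun G => -1 * X G) by rewrite gnp_EZ mulN1r.
  rewrite !gnp_Pr_E -lerN2 !EN.
  case/andP: q01 => q0 _; case/andP: p01 => _ p1.
  apply: ler_gnp_E_prob => // G H GH; rewrite !mulN1r lerN2 ler_nat.
  have: (chi H)^-1 <= (chi G)^-1.
    by rewrite lef_pV2 ?posrE ?susceptibility_gt0 ?ler_susceptibility.
  by move=> HG; case: (ltP _ (chi H)^-1) => // /lt_le_trans/(_ HG) ->.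
(* At [q] the gap is 4 k s, and 7 k s - 4 k s = 3 k s is the deviation allowed in the window. *)
by apply: ler_gnp_Pr => // G h; rewrite lter_normr; apply/orP; left; lra.
Qed.

End Susceptibility.

(** * Both estimates, with s = n^(-1/3) *)

Theorem corollary1p2 (R : realType) :
  (exists C : R, forall (n : nat) (p : R), (1 <= n)%N -> 0 <= p <= 1 ->
     `| (gnp_E p (@susceptibility R n))^-1 - Num.max (1 - n%:R * p) 0 |
       <= C * n%:R `^ (- (1 / 3)))
  /\
  (forall eps : R, 0 < eps ->
   exists C : R, forall (n : nat) (p : R), (1 <= n)%N -> 0 <= p <= 1 ->
     gnp_Pr p (fun G : graph n =>
       C * n%:R `^ (- (1 / 3))
         < `| (susceptibility R G)^-1 - Num.max (1 - n%:R * p) 0 |)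
     < eps).
Proof.
have s_gt0 n : (1 <= n)%N -> 0 < n%:R `^ (- (1 / 3)) :> R.
  by move=> n1; rewrite powR_gt0 // ltr0n.
have s3 n : (1 <= n)%N -> n%:R * (n%:R `^ (- (1 / 3))) ^+ 3 = 1 :> R.
  move=> n1; rewrite -powR_mulrn ?powR_ge0 // -powRrM.
  rewrite (_ : - (1 / 3) * 3%:R = -1 :> R); last by field.
  by rewrite powR_inv1 ?ler0n // divff // pnatr_eq0 -lt0n.
split.
  by exists 5 => n p n1 p01; apply: inv_gnp_E_susceptibility; rewrite ?s_gt0 ?s3.
(* The failure probability is at most 3 / (4 k), which this [k] makes smaller than [eps]. *)
move=> eps eps0; pose k := Num.max 1 eps^-1.
have k1 : 1 <= k by rewrite le_max lexx.
have k0 : 0 < k by apply: lt_le_trans k1.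
exists (7 * k) => n p n1 p01.
apply: le_lt_trans (inv_susceptibility n1 (s_gt0 n n1) (s3 n n1) p01 k1) _.
have h : eps^-1 <= k by rewrite le_max lexx orbT.
rewrite ltr_pdivrMr //; apply: (@lt_le_trans _ _ 1); first by lra.
by rewrite -ler_pdivrMl // mulr1.
Qed.
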